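(* Let $(F_n)_{n\ge 0}$ be the Fibonacci sequence, $F_0=0$, $F_1=F_2=1$, $F_{n}=F_{n-1}+F_{n-2}$. For positive integers $n,m$ define $G(1,n,m)=F_n^m$ and $G(k+1,n,m)=F_{n\,G(k,n,m)}$ for all $k\ge 1$. Then: (i) $F_n^{k+m-1}\mid G(k,n,m)$ for all integers $k,m,n\ge 1$. (ii) Let $k\ge 2$, $n\ge 3$ and $m\ge 1$ be integers. Then, modulo $F_n$, $$\frac{G(k,n,m)}{F_n^{k+m-1}}\equiv\begin{cases}1, & \text{if } 2\mid k \text{ and } 3\nmid n, \text{ or if } 2\nmid k,\ 3\nmid n,\ 4\nmid n;\\ F_{n-1}, & \text{if } 2\nmid k,\ 3\nmid n,\ 4\mid n;\\ \left(\frac{F_{n-3}}{2}\right)^{k-1}, & \text{if } 2\nmid k,\ 3\mid n,\ m\ge 2, \text{ or if } 2\mid k,\ 3\mid n,\ m=1;\\ (-1)^n\left(\frac{F_{n-3}}{2}\right)^{k-1}, & \text{if } 2\mid k,\ 3\mid n,\ m\ge 2, \text{ or if } 2\nmid k,\ 3\mid n,\ m=1.\end{cases}$$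
   Context: $F_n$ denotes the $n$th Fibonacci number with $F_0=0$, $F_1=F_2=1$. The quantity $G(k,n,m)/F_n^{k+m-1}$ is an integer by part (i); when $3\mid n$, $F_{n-3}$ is even so $F_{n-3}/2$ is an integer. *)

(* Defs.v *)
From mathcomp Require Import all_boot all_order all_algebra.

Set Implicit Arguments.
Unset Strict Implicit.
Unset Printing Implicit Defensive.

Fixpoint fib (n : nat) : nat :=
  if n is n'.+1 then
    if n' is n''.+1 then fib n' + fib n'' else 1
  else 0.

(* The sequence k |-> G k n m starts at k = 1; the value at k = 0 is a dummy. *)
Fixpoint G (k n m : nat) : nat :=
  if k is k'.+1 then
    if k' is _.+1 then fib (n * G k' n m) else fib n ^ m
  else 0.

(* Main.v *)
(** With [d = F_n] and [f = F_(n-1)], raising [Q ^ n = d Q + f I] (where [Q] is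
    the Fibonacci matrix) to the power [r] gives
    [F_(nr) = \sum_j 'C(r, j) d^j f^(r-j) F_j].  If [d^a] divides [r], the terms
    with [j >= 3] vanish modulo [d^(a+2)], so that [F_(nr) / d^(a+1)] is congruent
    to [(r / d^a) (f^(r-1) + (r-1) d/2 f^(r-2))] modulo [d].  For odd [d] the
    second summand disappears; for even [d] the bracket is [f^(r-2) F_(n-3)/2],
    because [r] is even and [2 f = d + F_(n-3)].  Taking [r = G(k, n, m)] and
    using [f^2 = (-1)^n] modulo [d], the residue of [G(k, n, m) / d^(k+m-1)]
    obeys a recursion in [k] that depends only on [G(k, n, m)] modulo 4. *)

Require Import Defs.
From mathcomp Require Import all_boot all_order all_algebra.
From mathcomp Require Import zify ring.

Set Implicit Arguments.
Unset Strict Implicit.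
Unset Printing Implicit Defensive.

Import GRing.Theory.

(** * Expansion of [fib (n * r)] in powers of [fib n] *)

Lemma fibSS n : fib n.+2 = fib n.+1 + fib n.
Proof. by []. Qed.

Lemma fib_gt0 n : 0 < n -> 0 < fib n.
Proof. by elim: n => // -[|n] IHn // _; rewrite fibSS ltn_addr ?IHn. Qed.

Lemma fib_gt1 n : 2 < n -> 1 < fib n.
Proof.
case: n => [|[|[|n]]] // _; rewrite !fibSS.
have := @fib_gt0 n.+1 isT; lia.
Qed.

Lemma fib_addS m n : fib (m + n.+1) = fib m.+1 * fib n.+1 + fib m * fib n.
Proof.
elim: n m => [|n IHn] m; first by rewrite addn1 /= muln1 muln0 addn0.
rewrite addnS -addSn IHn !fibSS; ring.
Qed.

Local Arguments fib : simpl never.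

(** The shift [s] makes the induction on [r] go through: the addition formula turns the hypothesis
    at [n.+1 + s] into the two halves of Pascal's rule. *)
Lemma fib_mulSD n r s :
  fib (n.+1 * r + s) =
  \sum_(j < r.+1) 'C(r, j) * (fib n.+1 ^ j * fib n ^ (r - j)) * fib (j + s).
Proof.
elim: r s => [|r IHr] s.
  by rewrite big_ord_recl big_ord0 muln0 bin0 !mul1n addn0.
rewrite mulnS -addnA addnCA IHr [RHS]big_ord_recl.
under [in RHS]eq_bigr => j _ do
  rewrite lift0 binS mulnDl mulnDl subSS.
(* The [j = 0] term and the ['C(r, j.+1)] half of Pascal's rule are reindexed as one sum, whose top
   term vanishes because ['C(r, r.+1) = 0]. *)
rewrite big_split /= addnA [X in _ = X + _](_ : _ =
  \sum_(j < r.+1) 'C(r, j) * (fib n.+1 ^ j * fib n ^ (r - j)) * fib n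
    * fib (j + s)); last first.
  rewrite big_ord_recr /= (bin_small (ltnSn r)) !mul0n addn0.
  rewrite [RHS]big_ord_recl; congr (_ + _).
    by rewrite !bin0 !subn0 !mul1n expnS mulnC; ring.
  apply: eq_bigr => j _; rewrite lift0.
  by rewrite (_ : r - j = (r - j.+1).+1) ?expnS; [ring | have := ltn_ord j; lia].
rewrite -big_split; apply: eq_bigr => j _ /=.
rewrite (_ : j + (n.+1 + s) = j + s + n.+1); last by lia.
rewrite fib_addS addSn expnS; ring.
Qed.

(** With [l = logn p j], one has [2 ^ l <= j], and [l + 2 <= 2 ^ l] once [l >= 2]. *)
Lemma logn_leq_sub2 p j : 2 < j -> logn p j <= j - 2.
Proof.
move=> j_gt2; case p_pr: (prime p); last by rewrite lognE p_pr.
case: (posnP (logn p j)) => [-> //|l_gt0].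
have: 2 ^ logn p j <= j.
  apply: leq_trans _ (dvdn_leq (ltnW (ltnW j_gt2)) (pfactor_dvdnn p j)).
  by rewrite leq_exp2r ?prime_gt1.
case: (logn p j) => [|[|l]]; [lia..|].
by have := ltn_expl l (isT : 1 < 2); rewrite !expnS; lia.
Qed.

(* Since [j * 'C(r, j) = r * 'C(r.-1, j.-1)], the powers of the primes dividing
   [d] that [j] can cancel from [r] are compensated by [d ^ (j - 2)]. *)
Lemma dvdn_bin_expn d a r j :
  d ^ a %| r -> 2 < j <= r -> d ^ (a + 2) %| 'C(r, j) * d ^ j.
Proof.
case: (posnP d) => [->|d_gt0] ar /andP[j_gt2 jr].
  by rewrite (_ : 0 ^ j = 0) ?muln0 // exp0n; lia.
have C_gt0 : 0 < 'C(r, j) by rewrite bin_gt0.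
apply/dvdn_partP => [|p _]; first by rewrite expn_gt0 d_gt0.
rewrite p_part; case p_pr: (prime p); last by rewrite lognE p_pr dvd1n.
rewrite pfactor_dvdn ?muln_gt0 ?C_gt0 ?expn_gt0 ?d_gt0 //.
rewrite lognM ?expn_gt0 ?d_gt0 // !lognX.
have jC : j * 'C(r, j) = r * 'C(r.-1, j.-1).
  by rewrite mul_bin_diag prednK //; lia.
have : d ^ a %| j * 'C(r, j) by rewrite jC dvdn_mulr.
move/(dvdn_leq_log p); rewrite muln_gt0 C_gt0 (leq_trans _ j_gt2) // lognX.
rewrite lognM //; last by lia.
move=> /(_ isT); have := logn_leq_sub2 p j_gt2.
case: (logn p d) => [|v]; first by rewrite !muln0.
nia.
Qed.

Lemma fib_mul_expansion a n r :
  fib n.+1 ^ a %| r -> 0 < r ->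
  exists t, fib (n.+1 * r) = r * fib n.+1 * fib n ^ (r - 1)
    + 'C(r, 2) * fib n.+1 ^ 2 * fib n ^ (r - 2) + fib n.+1 ^ (a + 2) * t.
Proof.
case: r => [|[|r]] // dr _.
  by exists 0; rewrite bin_small // subnn muln1; ring.
have := fib_mulSD n r.+2 0; rewrite addn0 => ->.
rewrite !big_ord_recl /= /bump /= !addn0 /= bin1.
under eq_bigr do rewrite !add1n.
set S := \sum_(i < r) _; have /dvdnP[t ->] : fib n.+1 ^ (a + 2) %| S.
  apply: dvdn_sum => i _; rewrite dvdn_mulr // mulnA dvdn_mulr // dvdn_bin_expn //.
  by have := ltn_ord i; lia.
by exists t; rewrite add1n -[fib 0]/0 -[fib 1]/1 -[fib 2]/1; ring.
Qed.

Lemma bin2_mul2 r : 'C(r, 2) * 2 = r * (r - 1).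
Proof. by rewrite mulnC subn1 -mul_bin_diag bin1. Qed.

(** As 2 is coprime to [fib n.+1], the identity ['C(r, 2) * 2 = r * (r - 1)] puts the quadratic term
    in the error. *)
Lemma fib_mul_quotient_odd a n r q :
  odd (fib n.+1) -> r = q * fib n.+1 ^ a -> 0 < r ->
  exists q' t, fib (n.+1 * r) = q' * fib n.+1 ^ a.+1
    /\ q' = q * fib n ^ (r - 1) + fib n.+1 * t.
Proof.
move=> d_odd rE r_gt0; have dr : fib n.+1 ^ a %| r by rewrite rE dvdn_mull.
have [t ->] := fib_mul_expansion dr r_gt0.
have /dvdnP[c ->] : fib n.+1 ^ a %| 'C(r, 2).
  rewrite -(@Gauss_dvdl _ _ 2); first by rewrite bin2_mul2 dvdn_mulr.
  by rewrite coprimen2 oddX d_odd orbT.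
exists (q * fib n ^ (r - 1) + fib n.+1 * (c * fib n ^ (r - 2) + t)).
eexists; split; last by [].
by rewrite [X in X * _ * _]rE addn2 !expnS; ring.
Qed.

(** The exponent [a.+1] makes the even number [fib n.+1] divide [r], so [r] is even and the
    quadratic term contributes to the residue. *)
Lemma fib_mul_quotient_even a n r q h :
  2 * fib n = fib n.+1 + 2 * h -> r = q * fib n.+1 ^ a.+1 -> 0 < r ->
  exists q' t, fib (n.+1 * r) = q' * fib n.+1 ^ a.+2
    /\ q' = q * fib n ^ (r - 2) * h + fib n.+1 * t.
Proof.
move=> fE rE r_gt0.
have dr : fib n.+1 ^ a.+1 %| r by rewrite rE dvdn_mull.
have [t ->] := fib_mul_expansion dr r_gt0.
have [e dE] : exists e, fib n.+1 = 2 * e by exists (fib n - h); lia.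
have {}fE : fib n = e + h by lia.
have [s sE] : exists s, r = 2 * s.
  by exists (q * e * fib n.+1 ^ a); rewrite rE expnS dE; ring.
have -> : 'C(r, 2) = q * fib n.+1 ^ a * e * (r - 1).
  apply/eqP; rewrite -(eqn_pmul2r (isT : 0 < 2)) bin2_mul2.
  by rewrite [X in X * _ == _]rE expnS {1}dE; apply/eqP; ring.
exists (q * fib n ^ (r - 2) * h
  + fib n.+1 * (q * fib n ^ (r - 2) * s + t)).
eexists; split; last by [].
(* The part with [e] joins the quadratic term to give [e * r = 2 * e * s], a multiple of [fib n.+1];
   only [h] survives. *)
have -> : fib n ^ (r - 1) = (e + h) * fib n ^ (r - 2).
  by rewrite -fE -expnS; congr (_ ^ _); lia.
have r1 : r - 1 + 1 = 2 * s by lia.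
rewrite [X in X * _ * _]rE addn2 !expnS.
have -> : fib n.+1 * (q * fib n ^ (r - 2) * s + t) =
  q * fib n ^ (r - 2) * e * (r - 1 + 1) + fib n.+1 * t by rewrite r1 dE; ring.
by rewrite dE; ring.
Qed.

(** * Periodicity modulo 2, 3 and 4, and Cassini's identity *)

Lemma even_fib n : (2 %| fib n) = (3 %| n).
Proof.
have [q [r [r3 ->]]] : exists q r, r < 3 /\ n = q * 3 + r.
  by exists (n %/ 3), (n %% 3); rewrite ltn_mod -divn_eq.
elim: q => [|q IHq]; first by move: r r3 => [|[|[|]]].
rewrite mulSn -addnA !(addSn, add0n) !fibSS.
by move: IHq; lia.
Qed.

Lemma dvdn3_fib n : (3 %| fib n) = (4 %| n).
Proof.
have [q [r [r4 ->]]] : exists q r, r < 4 /\ n = q * 4 + r.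
  by exists (n %/ 4), (n %% 4); rewrite ltn_mod -divn_eq.
elim: q => [|q IHq]; first by move: r r4 => [|[|[|[|]]]].
rewrite mulSn -addnA !(addSn, add0n) !fibSS.
by move: IHq; lia.
Qed.

Lemma fib_mod4 n : odd n -> fib n %% 4 = if 3 %| n then 2 else 1.
Proof.
have [q [r [r6 ->]]] : exists q r, r < 6 /\ n = q * 6 + r.
  by exists (n %/ 6), (n %% 6); rewrite ltn_mod -divn_eq.
elim: q => [|q IHq]; first by move: r r6 => [|[|[|[|[|[|]]]]]].
move=> n_odd; have {IHq} := IHq ltac:(lia).
rewrite mulSn -addnA (_ : 3 %| _ = (3 %| q * 6 + r)); last by lia.
by rewrite !(addSn, add0n) !fibSS; case: ifP; lia.
Qed.

(** The two booleans encode the sign without subtraction in [nat]. *)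
Lemma cassini n : fib n.+1 ^ 2 + odd n = fib n * fib n.+2 + ~~ odd n.
Proof.
elim: n => [|n IHn]; first exact: erefl.
have : fib n.+3 = fib n.+2 + fib n.+1 by [].
have : fib n.+2 = fib n.+1 + fib n by [].
move: IHn => /= + E2 E3; rewrite E3 negbK => {E3}.
by case: (odd n); rewrite E2 /= !expnS expn0; nia.
Qed.

(** * Positivity and small residues of [G] *)

Lemma GS k n m : G k.+2 n m = fib (n * G k.+1 n m).
Proof. by []. Qed.

Lemma G_gt0 k n m : 0 < n -> 0 < G k.+1 n m.
Proof.
move=> n_gt0; elim: k => [|k IHk]; first by rewrite /= expn_gt0 fib_gt0.
by rewrite GS fib_gt0 // muln_gt0 n_gt0.
Qed.

(** The claims feed each other: oddness excludes the factor 3 at the next step, and the absence of 3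
    gives oddness and the residue modulo 4. *)
Lemma G_coprime6 k n m : ~~ (3 %| n) -> ~~ (4 %| n) ->
  [/\ odd (G k.+1 n m), ~~ (3 %| G k.+1 n m)
    & odd n -> G k.+1 n m = 1 %[mod 4]].
Proof.
move=> n3 n4; elim: k => [|k [odd_r r3 r4]].
  split.
  - by rewrite /= oddX -[odd _]negbK -dvdn2 even_fib n3 orbT.
  - by rewrite /= Euclid_dvdX // dvdn3_fib (negPf n4).
  - by move=> n_odd; rewrite /= -modnXm fib_mod4 // (negPf n3) exp1n.
have nr3 : ~~ (3 %| n * G k.+1 n m) by rewrite Euclid_dvdM // negb_or n3.
rewrite GS; split.
- by rewrite -[odd _]negbK -dvdn2 even_fib.
- by rewrite dvdn3_fib Gauss_dvdl // -[4]/(2 ^ 2) coprimeXl // coprime2n.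
- by move=> n_odd; rewrite fib_mod4 ?oddM ?n_odd // (negPf nr3).
Qed.

Lemma dvdn3_G k n m : 4 %| n -> 0 < m -> 3 %| G k.+1 n m.
Proof.
move=> n4 m_gt0; case: k => [|k]; first by rewrite dvdn_exp // dvdn3_fib.
by rewrite GS dvdn3_fib dvdn_mulr.
Qed.

(** * Residues of the quotients in ['Z_d] *)

Section Residues.

Local Open Scope ring_scope.

Lemma eqz_mod_Zp (d : nat) (q z : int) :
  (1 < d)%N -> q%:~R = z%:~R :> 'Z_d -> (q = z %[mod d])%Z.
Proof.
move=> d_gt1 /eqP; rewrite -subr_eq0 -intrB => /eqP qz.
apply/eqP; rewrite eqz_mod_dvd; move: qz; set x := q - z.
have natr0 (m : nat) : m%:R = 0 :> 'Z_d -> (d %| m)%N.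
  by move=> /(congr1 val); rewrite /= val_Zp_nat // => /eqP.
rewrite dvdzE; case: x => m; first exact: natr0.
rewrite NegzE intrN => /eqP; rewrite oppr_eq0 => /eqP.
by rewrite abszN; apply: natr0.
Qed.

(** The index of the theorem is [n.+2] here; [n_gt0] makes it at least 3, so that [d > 1] and ['Z_d]
    really has modulus [d]. *)
Variable n : nat.
Hypothesis n_gt0 : (0 < n)%N.
Let d := fib n.+2.
Let f := fib n.+1.

Let d_gt1 : (1 < d)%N. Proof. exact: fib_gt1. Qed.

Lemma fib_pred_sq_Zp : f%:R ^+ 2 = (-1) ^+ n.+2 :> 'Z_d.
Proof.
have /(congr1 (fun x => x%:R : 'Z_d)) := cassini n.
rewrite !natrD natrM natrX pchar_Zp // mulr0 add0r -signr_odd /= negbK.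
case: (odd n) => /= [/eqP|]; last by rewrite addr0.
by rewrite addr_eq0 => /eqP.
Qed.

Lemma fib_pred_even_exp_Zp s : f%:R ^+ (2 * s) = (-1) ^+ (n.+2 * s) :> 'Z_d.
Proof. by rewrite exprM fib_pred_sq_Zp -exprM. Qed.

Lemma fib_mul_residue_odd a r q : odd d -> r = (q * d ^ a)%N -> (0 < r)%N ->
  exists2 q', fib (n.+2 * r) = (q' * d ^ a.+1)%N
    & q'%:R = q%:R * f%:R ^+ (r - 1) :> 'Z_d.
Proof.
move=> d_odd rE r_gt0.
have [q' [t [qE q'E]]] := fib_mul_quotient_odd d_odd rE r_gt0.
exists q'; rewrite // q'E natrD [(fib n.+2 * t)%:R]natrM -/d pchar_Zp //.
by rewrite mul0r addr0 natrM natrX.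
Qed.

Lemma fib_mul_residue_even h a r q :
  (2 * f = d + 2 * h)%N -> r = (q * d ^ a.+1)%N -> (0 < r)%N ->
  exists2 q', fib (n.+2 * r) = (q' * d ^ a.+2)%N
    & q'%:R = q%:R * f%:R ^+ (r - 2) * h%:R :> 'Z_d.
Proof.
move=> fE rE r_gt0.
have [q' [t [qE q'E]]] := fib_mul_quotient_even fE rE r_gt0.
exists q'; rewrite // q'E natrD [(fib n.+2 * t)%:R]natrM -/d pchar_Zp //.
by rewrite mul0r addr0 !natrM natrX.
Qed.

(** Each step multiplies by [f ^ (r - 1)] with [r] odd, a power of the sign; it is 1 since the index
    is even or [r] is 1 modulo 4. *)
Lemma G_residue_coprime12 k m : ~~ (3 %| n.+2)%N -> ~~ (4 %| n.+2)%N ->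
  exists2 q, G k.+1 n.+2 m = (q * d ^ (k + m))%N & q%:R = 1 :> 'Z_d.
Proof.
move=> n3 n4; have d_odd : odd d by rewrite -[odd _]negbK -dvdn2 even_fib.
elim: k => [|k [q GE qE]]; first by exists 1%N; rewrite // mul1n.
have [odd_r _ r4] := G_coprime6 k m n3 n4.
have [q' q'G q'E] := fib_mul_residue_odd d_odd GE (@G_gt0 k n.+2 m isT).
exists q' => //; rewrite q'E qE mul1r.
have [s rE] : exists s, G k.+1 n.+2 m = (2 * s).+1.
  by exists (G k.+1 n.+2 m)./2; lia.
rewrite rE subn1 /= fib_pred_even_exp_Zp -signr_odd.
have -> : odd (n.+2 * s) = false; last by [].
rewrite oddM; case n_odd: (odd _) => //=.
by have := r4 n_odd; rewrite rE; lia.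
Qed.

(** Here [f ^ 2 = 1]. The first step has [r = d ^ m] odd and contributes 1; all later [r] are even
    and contribute [f]. *)
Lemma G_residue_dvd4 k m : ~~ (3 %| n.+2)%N -> (4 %| n.+2)%N -> (0 < m)%N ->
  exists2 q, G k.+1 n.+2 m = (q * d ^ (k + m))%N
    & q%:R = (if (0 < k)%N && ~~ odd k then f%:R else 1) :> 'Z_d.
Proof.
move=> n3 n4 m_gt0.
have d_odd : odd d by rewrite -[odd _]negbK -dvdn2 even_fib.
have n_even : odd n.+2 = false by lia.
elim: k => [|k [q GE qE]]; first by exists 1%N; rewrite // mul1n.
have [q' q'G q'E] := fib_mul_residue_odd d_odd GE (@G_gt0 k n.+2 m isT).
exists q' => //; rewrite q'E qE.
have f_even s : f%:R ^+ (2 * s) = 1 :> 'Z_d.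
  by rewrite fib_pred_even_exp_Zp -signr_odd oddM n_even.
case: k GE {qE q' q'G q'E} => [|k] GE.
  rewrite /= mul1r -[RHS](f_even (d ^ m - 1)./2); congr (_ ^+ _).
  have : odd (d ^ m) by rewrite oddX d_odd orbT.
  by rewrite -/d; lia.
have r_even : odd (G k.+2 n.+2 m) = false.
  by apply/negbTE; rewrite -dvdn2 GS even_fib dvdn_mull // dvdn3_G.
have [s ->] : exists s, (G k.+2 n.+2 m - 1 = (2 * s).+1)%N.
  exists ((G k.+2 n.+2 m)./2 - 1)%N.
  by have := @G_gt0 k.+1 n.+2 m isT; lia.
rewrite exprSr f_even mul1r /=; case: (odd k) => /=; rewrite ?mul1r //.
by rewrite -expr2 -[2%N]muln1 f_even.
Qed.

(* Each step contributes the sign [(-1) ^ n], since 4 divides [G k.+1 n.+2 m],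
   except the first one when [m = 1], where [G 1 n 1 = fib n] is 2 modulo 4 for
   odd [n]; hence the truncated [k - (m == 1)]. *)
Lemma G_residue_dvd3 h k m : (3 %| n.+2)%N -> (0 < m)%N ->
  (2 * f = d + 2 * h)%N ->
  exists2 q, G k.+1 n.+2 m = (q * d ^ (k + m))%N
    & q%:R = (-1) ^+ (n.+2 * (k - (m == 1))) * h%:R ^+ k :> 'Z_d.
Proof.
move=> n3 m_gt0 fE.
have d_even : odd d = false by apply/negbTE; rewrite -dvdn2 even_fib.
elim: k => [|k [q GE qE]]; first by exists 1%N; rewrite ?mul1n // muln0 mul1r.
have [a aE] : exists a, (k + m = a.+1)%N by exists (k + m).-1; lia.
rewrite aE in GE.
have [q' q'G q'E] := fib_mul_residue_even fE GE (@G_gt0 k n.+2 m isT).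
exists q'; first by rewrite addSn aE.
rewrite q'E qE exprSr mulrA; congr (_ * _); rewrite mulrAC; congr (_ * _).
case: (boolP ((k == 0) && (m == 1)))%N => [/andP[/eqP k0 /eqP m1]|km].
  rewrite k0 m1 subnn muln0 mul1r /= expn1 -/d.
  (* For an odd index [d] is 2 modulo 4, so [s - 1] is even and no sign appears. *)
  have [s dE] : exists s, d = (2 * s)%N by exists d./2; lia.
  rewrite (_ : d - 2 = 2 * (s - 1))%N; last by lia.
  rewrite fib_pred_even_exp_Zp -signr_odd.
  have -> : odd (n.+2 * (s - 1)) = false; last by [].
  rewrite oddM; case n_odd: (odd _) => //=.
  by have := @fib_mod4 n.+2 n_odd; rewrite n3 -/d dE; lia.
have -> : (k.+1 - (m == 1) = (k - (m == 1)).+1)%N by move: km; lia.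
rewrite mulnS exprD mulrC; congr (_ * _).
(* Outside the exceptional case [k + m >= 2], so the even number [d] divides [r] at least twice. *)
have [s rE] : exists s, G k.+1 n.+2 m = (4 * s)%N.
  have [[|b] aE'] : exists b, a = b by exists a.
    by move: km; lia.
  have [e dE] : exists e, d = (2 * e)%N by exists d./2; lia.
  by exists (q * e ^ 2 * d ^ b)%N; rewrite GE aE' !expnS dE; ring.
have s_gt0 : (0 < s)%N by have := @G_gt0 k n.+2 m isT; lia.
rewrite (_ : _ - 2 = 2 * (2 * (s - 1)).+1)%N; last by rewrite rE; lia.
rewrite fib_pred_even_exp_Zp mulnS mulnCA exprD exprM sqrrN.
by rewrite !expr1n mulr1.
Qed.

End Residues.

Theorem theorem1p1 :
  (forall k n m : nat, 1 <= k -> 1 <= n -> 1 <= m ->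
     fib n ^ (k + m - 1) %| G k n m) /\
  (forall k n m : nat, 2 <= k -> 3 <= n -> 1 <= m ->
     let q : int := Posz (G k n m %/ fib n ^ (k + m - 1)) in
     let h : int := Posz (fib (n - 3) %/ 2) in
     let d : int := Posz (fib n) in
     [/\ (2 %| k /\ ~~ (3 %| n)) \/ [/\ ~~ (2 %| k), ~~ (3 %| n) & ~~ (4 %| n)] ->
           (q = 1 %[mod d])%Z,
         [/\ ~~ (2 %| k), ~~ (3 %| n) & 4 %| n] ->
           (q = Posz (fib (n - 1)) %[mod d])%Z,
         [/\ ~~ (2 %| k), 3 %| n & 2 <= m] \/ [/\ 2 %| k, 3 %| n & m = 1] ->
           (q = (h ^+ (k - 1))%R %[mod d])%Z
       & [/\ 2 %| k, 3 %| n & 2 <= m] \/ [/\ ~~ (2 %| k), 3 %| n & m = 1] ->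
           (q = ((-1) ^+ n * h ^+ (k - 1))%R %[mod d])%Z]).
Proof.
(* This supplies [h] as half of [fib n], three places below the index [n.+3]. *)
have half n : 3 %| n.+3 -> 2 * fib n.+2 = fib n.+3 + 2 * (fib n %/ 2).
  move=> n3; have : 2 %| fib n by rewrite even_fib; lia.
  by rewrite !fibSS; lia.
split.
  (* Indices 1 and 2 have Fibonacci number 1, outside the scope of the residue lemmas. *)
  move=> [//|k] [//|[|[|n]]] m _ _ m_gt0; rewrite ?exp1n ?dvd1n //.
  rewrite (_ : k.+1 + m - 1 = k + m); last by lia.
  case: (boolP (3 %| n.+3)) => n3.
    by have [q -> _] := G_residue_dvd3 (isT : 0 < n.+1) k n3 m_gt0 (half _ n3);
       apply: dvdn_mull.
  case: (boolP (4 %| n.+3)) => n4.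
    by have [q -> _] := G_residue_dvd4 (isT : 0 < n.+1) k n3 n4 m_gt0;
       apply: dvdn_mull.
  by have [q -> _] := G_residue_coprime12 (isT : 0 < n.+1) k m n3 n4;
     apply: dvdn_mull.
move=> [|[//|k]] // [|[|[|n]]] // m _ _ m_gt0 q h d.
have d_gt1 : 1 < fib n.+3 by exact: fib_gt1.
have qE q' : G k.+2 n.+3 m = q' * fib n.+3 ^ (k.+1 + m) -> q = q'.
  rewrite /q (_ : k.+2 + m - 1 = k.+1 + m) => [->|]; last by lia.
  by rewrite mulnK // expn_gt0 (ltnW d_gt1).
rewrite !subSS !subn0 in h *.
split.
- case=> [[k2 n3]|[k2 n3 n4]].
    case: (boolP (4 %| n.+3)) => n4; last first.
      have [q' /qE -> q'E] := G_residue_coprime12 (isT : 0 < n.+1) k.+1 m n3 n4.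
      exact: eqz_mod_Zp.
    have [q' /qE -> q'E] := G_residue_dvd4 (isT : 0 < n.+1) k.+1 n3 n4 m_gt0.
    apply: eqz_mod_Zp => //; rewrite [LHS]q'E.
    by have -> : odd k.+1 by lia.
  have [q' /qE -> q'E] := G_residue_coprime12 (isT : 0 < n.+1) k.+1 m n3 n4.
  exact: eqz_mod_Zp.
- case=> k2 n3 n4.
  have [q' /qE -> q'E] := G_residue_dvd4 (isT : 0 < n.+1) k.+1 n3 n4 m_gt0.
  apply: eqz_mod_Zp => //; rewrite [LHS]q'E.
  by have -> : odd k.+1 = false by lia.
- move=> H; have n3 : 3 %| n.+3 by case: H => -[].
  have [q' /qE -> q'E] := G_residue_dvd3 (isT : 0 < n.+1) k.+1 n3 m_gt0 (half _ n3).
  apply: eqz_mod_Zp => //; rewrite [LHS]q'E rmorphXn /= -signr_odd oddM.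
  (* The theorem's [k] is [k.+2] here; both alternatives make the exponent of the sign even. *)
  have -> : odd (k.+1 - (m == 1)) = false.
    by case: H => -[k2 _ mE]; move: k2 mE; case: eqP; lia.
  by rewrite andbF mul1r.
- move=> H; have n3 : 3 %| n.+3 by case: H => -[].
  have [q' /qE -> q'E] := G_residue_dvd3 (isT : 0 < n.+1) k.+1 n3 m_gt0 (half _ n3).
  apply: eqz_mod_Zp => //; rewrite [LHS]q'E rmorphM /= !rmorphXn /= rmorphN1.
  rewrite -signr_odd oddM.
  have -> : odd (k.+1 - (m == 1)).
    by case: H => -[k2 _ mE]; move: k2 mE; case: eqP; lia.
  by rewrite andbT signr_odd.
Qed.
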